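(* Let $d\geqslant 3$ be an integer and let $r$ be an integer with $0<r<d$ and $2r\ne d$. Let $n\geqslant d+r$ be an integer. Then $$\sum_{k=0}^{n-1}\frac{(q^{-r},q^{-r},q^{2r-d};q^d)_k}{(q^d;q^d)_k^3 }\,q^{dk} \equiv 0\pmod{\Phi_n(q)^2}\quad\text{for } n\equiv r\pmod{d}.$$
   Context: Here $q$ is an indeterminate. Notation: $(a;q)_k=(1-a)(1-aq)\cdots(1-aq^{k-1})$ for $k\ge 1$, $(a;q)_0=1$, and $(a_1,\ldots,a_m;q)_k=(a_1;q)_k\cdots(a_m;q)_k$ (so $(x;q^d)_k=\prod_{i=0}^{k-1}(1-xq^{di})$). $\Phi_n(q)$ is the $n$-th cyclotomic polynomial in $q$. For a rational function $A(q)$ and a polynomial $P(q)$, $A(q)\equiv 0\pmod{P(q)}$ means that $A(q)=P(q)U(q)/V(q)$ with polynomials $U,V$ (over $\mathbb{Q}$), where $V$ is relatively prime to $P$. *)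

(* Defs.v *)
From mathcomp Require Import all_boot all_order all_algebra all_field.

Set Implicit Arguments.
Unset Strict Implicit.
Unset Printing Implicit Defensive.
Import GRing.Theory.
Local Open Scope ring_scope.

Notation Qq := {fraction {poly rat}}.

Definition q : Qq := tofrac 'X.

Definition qpoch (K : fieldType) (a x : K) (k : nat) : K :=
  \prod_(0 <= i < k) (1 - a * x ^+ i).

Definition qpochs (K : fieldType) (s : seq K) (x : K) (k : nat) : K :=
  \prod_(a <- s) qpoch a x k.

Definition PhiQ (n : nat) : {poly rat} := map_poly intr 'Phi_n.

(* V != 0 is not implied by coprimep V P when P is a nonzero constant. *)
Definition rat_congr0 (A : Qq) (P : {poly rat}) : Prop :=
  exists U V : {poly rat},
    [/\ V != 0, coprimep V P & A = tofrac P * (tofrac U / tofrac V)].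

(* Main.v *)
Require Import Defs.
From mathcomp Require Import all_boot all_order all_algebra all_field.
From mathcomp Require Import ring zify.

Set Implicit Arguments.
Unset Strict Implicit.
Unset Printing Implicit Defensive.
Import GRing.Theory.
Local Open Scope ring_scope.

(** Put Q = q^d, w = q^n and n = d t + r with t >= 1. Then q^(-r) = Q^t w^(-1)
    and q^(2r-d) = Q^(-2t-1) w^2. With g = gcd(n, d), N = n / g and D = d / g,
    we have Q^N = w^D, and Q has order N modulo Phi_n. The number w is 1 modulo
    Phi_n, and e = w - 1 is Phi_n times a unit of the ring O of rational
    functions that are regular at Phi_n; so everything can be computed in O
    modulo e^2.

    When g > 1 the denominators vanish modulo Phi_n, so the sum is cut into g
    blocks of length N. The block starting at k = m N is the summand at m N,
    which lies in O ([O_summand]), times the value at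
    (l-1, l-1, l+2; l, l, l), where l = m D, of

      F(i1,i2,i3; j1,j2,j3) = sum_(k < N) Q^k
        (Q^t w^i1, Q^t w^i2, Q^(-2t-1) w^i3; Q)_k
          / (Q w^j1, Q w^j2, Q w^j3; Q)_k.

    The denominators of F are units of O, and w^i = 1 + i e modulo e^2, so F is
    an affine function of the six exponents modulo e^2 ([affine_block_sum]).
    It therefore suffices to know enough exact zeros of F. They all come from
    the q-binomial theorem in the form

      sum_k Q^k (Q^(-M); Q)_k / (Q; Q)_k p(Q^k) = 0   when deg p < M

    ([qbinom_sum]), because (Q^(s+1) y; Q)_k / (Q y; Q)_k is a polynomial in Q^k
    of degree s ([qpoch_ratio_poly]). The third numerator Q^(-2t-1) gives
    F(0) = 0; the first one, since Q^t w^(-D) = Q^(-(N-t)), gives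
    F(-D, j, D+k; 0, j, k) = 0 for all j and k, and the second one does the same
    by symmetry. The point wanted is a combination of these zeros with
    denominator D, and D is invertible in O; this gives the vanishing modulo
    e^2 ([dvdO_block_sum]). *)

(** * Terminating q-series with polynomial factors *)

Section QSeries.
Variable K : fieldType.
Implicit Types (a x z : K).

Lemma qpoch0 a x : qpoch a x 0 = 1.
Proof. by rewrite /qpoch big_geq. Qed.

Lemma qpochS a x k : qpoch a x k.+1 = qpoch a x k * (1 - a * x ^+ k).
Proof. by rewrite /qpoch big_nat_recr. Qed.

Lemma qpochD a x m k :
  qpoch a x (m + k) = qpoch a x m * qpoch (a * x ^+ m) x k.
Proof.
elim: k => [|k IHk]; first by rewrite addn0 qpoch0 mulr1.
by rewrite addnS !qpochS IHk -!mulrA -exprD.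
Qed.

Lemma qpochSl a x k : qpoch a x k.+1 = (1 - a) * qpoch (a * x) x k.
Proof. by rewrite -add1n qpochD qpochS qpoch0 expr0 expr1 mulr1 mul1r. Qed.

Lemma qpoch_neq0 a x k :
  (forall i, (i < k)%N -> 1 - a * x ^+ i != 0) -> qpoch a x k != 0.
Proof.
elim: k => [|k IHk] nz; first by rewrite qpoch0 oner_neq0.
by rewrite qpochS mulf_neq0 ?nz // IHk // => i ik; apply: nz; rewrite ltnS ltnW.
Qed.

Lemma qpoch_eq0 a x k i : (i < k)%N -> a * x ^+ i = 1 -> qpoch a x k = 0.
Proof.
move=> ik ax; rewrite -(subnKC ik) qpochD qpochS ax subrr mulr0.
exact: mul0r.
Qed.

(** (z x^-M; x)_M as a polynomial in z, with its factors in reverse order so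
    that passing from M to M + 1 adds one factor at the end. *)
Definition qbinom_poly x M : {poly K} :=
  \prod_(0 <= i < M) (1 - (x ^- i.+1)%:P * 'X).

(** The q-binomial theorem, by the q-Pascal rule on coefficients. *)
Lemma coef_qbinom_poly x M k : x != 0 ->
    (forall k, (0 < k)%N -> x ^+ k != 1) ->
  (qbinom_poly x M)`_k = qpoch (x ^- M) x k / qpoch x x k.
Proof.
move=> x0 xk; elim: M k => [|M IHM] k.
  rewrite /qbinom_poly big_geq // coef1; case: k => [|k].
    by rewrite !qpoch0 divr1.
  by rewrite (@qpoch_eq0 _ _ _ 0) ?mul0r // !expr0 invr1 mul1r.
rewrite /qbinom_poly big_nat_recr //= -/(qbinom_poly x M).
rewrite mulrBr mulr1 mulrCA coefB coefCM coefMX !IHM.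
case: k => [|k] /=; first by rewrite mulr0 subr0 !qpoch0.
have nz k0 : qpoch x x k0 != 0.
  by apply: qpoch_neq0 => i _; rewrite -exprS subr_eq0 eq_sym xk.
have nzk : 1 - x * x ^+ k != 0 by rewrite -exprS subr_eq0 eq_sym xk.
rewrite (qpochSl (x ^- M.+1)) (qpochS x) (qpochS (x ^- M)).
have -> : x ^- M = x ^- M.+1 * x by rewrite exprSr invfM divfK.
have := nz k; have : x ^+ M.+1 != 0 by rewrite expf_neq0.
by move: nzk => ? ? ?; field; do ?[apply/andP; split].
Qed.

Lemma size_linear_prod (c : nat -> K) s :
  (size (\prod_(0 <= i < s) (1 - (c i)%:P * 'X))%R <= s.+1)%N.
Proof.
elim: s => [|s IHs]; first by rewrite big_geq // size_poly1.
rewrite big_nat_recr //=; apply: leq_trans (size_polyMleq _ _) _.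
have : (size (1 - (c s)%:P * 'X)%R <= 2)%N.
  rewrite (leq_trans (size_polyD _ _)) // geq_max size_poly1 size_polyN.
  by rewrite (leq_trans (size_polyMleq _ _)) // size_polyX size_polyC; case: eqP.
by move: IHs; set A := size _; set B := size _; lia.
Qed.

(** For p = z^j the sum is the q-binomial polynomial at x^(j+1), which is one
    of its roots x, ..., x^M as long as j < M. *)
Lemma qbinom_sum x M L (p : {poly K}) : x != 0 ->
    (forall k, (0 < k)%N -> x ^+ k != 1) -> (M < L)%N -> (size p <= M)%N ->
  \sum_(0 <= k < L) x ^+ k * (qpoch (x ^- M) x k / qpoch x x k) * p.[x ^+ k] = 0.
Proof.
move=> x0 xk ML szp.
under eq_bigr => k _ do rewrite (horner_coef_wide _ szp) mulr_sumr.
rewrite exchange_big big1 //= => j _.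
transitivity (p`_j * (qbinom_poly x M).[x ^+ j.+1]).
  rewrite (@horner_coef_wide _ L) ?(leq_trans (size_linear_prod _ _)) //.
  rewrite big_mkord mulr_sumr; apply: eq_bigr => k _.
  rewrite coef_qbinom_poly // [(x ^+ j.+1) ^+ k]exprAC (exprS (x ^+ k)).
  by ring.
rewrite /qbinom_poly horner_prod.
rewrite (big_cat_nat (n := j)) //=; last exact: ltnW.
rewrite (@big_ltn _ _ _ j) // !hornerE.
by rewrite mulVf ?expf_neq0 // subrr /= mulr0 mul0r.
Qed.

(** Splitting (x y; x)_(s+k) after s or after k factors gives
    (x^(s+1) y; x)_k / (x y; x)_k = (x^(k+1) y; x)_s / (x y; x)_s, where k
    occurs only through x^k. *)
Lemma qpoch_ratio_poly x y s L : (s < L)%N ->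
    (forall k, (k < L)%N -> qpoch (x * y) x k != 0) ->
  exists2 p : {poly K}, (size p <= s.+1)%N &
    forall k, (k < L)%N ->
      qpoch (x ^+ s.+1 * y) x k / qpoch (x * y) x k = p.[x ^+ k].
Proof.
move=> sL nz.
exists ((qpoch (x * y) x s)^-1%:P *
         \prod_(0 <= i < s) (1 - (x * y * x ^+ i)%:P * 'X)).
  rewrite mul_polyC; apply: leq_trans (size_scale_leq _ _) _.
  exact: size_linear_prod.
move=> k kL; rewrite hornerM hornerC horner_prod.
have -> : \prod_(0 <= i < s) (1 - (x * y * x ^+ i)%:P * 'X).[x ^+ k]
        = qpoch (x * y * x ^+ k) x s.
  by apply: eq_bigr => i _; rewrite !hornerE; ring.
apply/eqP; rewrite mulrC eq_sym mulrC -subr_eq0.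
have := qpochD (x * y) x k s; rewrite addnC qpochD.
have -> : x * y * x ^+ s = x ^+ s.+1 * y by rewrite exprS; ring.
move: (nz k kL) (nz s sL) => nk ns /(canRL (mulKf ns)) ->.
by rewrite subr_eq0; apply/eqP; field; rewrite nk ns.
Qed.

Lemma qsum_vanish x M s1 s2 y1 y2 L : x != 0 ->
    (forall k, (0 < k)%N -> x ^+ k != 1) -> (M < L)%N -> (s1 + s2 < M)%N ->
    (forall k, (k < L)%N -> qpoch (x * y1) x k != 0) ->
    (forall k, (k < L)%N -> qpoch (x * y2) x k != 0) ->
  \sum_(0 <= k < L) x ^+ k * (qpoch (x ^- M) x k / qpoch x x k)
     * (qpoch (x ^+ s1.+1 * y1) x k / qpoch (x * y1) x k)
     * (qpoch (x ^+ s2.+1 * y2) x k / qpoch (x * y2) x k) = 0.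
Proof.
move=> x0 xk ML sM nz1 nz2.
have [|p1 sp1 p1E] := qpoch_ratio_poly _ nz1 (s := s1); first by lia.
have [|p2 sp2 p2E] := qpoch_ratio_poly _ nz2 (s := s2); first by lia.
have szp : (size (p1 * p2)%R <= M)%N.
  apply: leq_trans (size_polyMleq _ _) _.
  by move: sp1 sp2; set A := size _; set B := size _; lia.
apply: etrans (qbinom_sum x0 xk ML szp); rewrite big_nat [RHS]big_nat.
by apply: eq_bigr => k /andP[_ kL]; rewrite p1E // p2E // hornerM -[LHS]mulrA.
Qed.

End QSeries.

(** * First-order expansions modulo the square of w - 1 *)

Section FirstOrder.
Variables (K : fieldType) (O : K -> Prop).
Hypotheses (O1 : O 1) (OB : forall x y, O x -> O y -> O (x - y))
  (OM : forall x y, O x -> O y -> O (x * y)).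

Lemma O0 : O 0. Proof. by rewrite -(subrr 1); apply: OB. Qed.
Lemma ON x : O x -> O (- x).
Proof. by move=> Ox; rewrite -sub0r; apply: OB => //; apply: O0. Qed.
Lemma OD x y : O x -> O y -> O (x + y).
Proof. by move=> Ox Oy; rewrite -[y]opprK; apply: OB => //; apply: ON. Qed.
Lemma OX x k : O x -> O (x ^+ k).
Proof. by move=> Ox; elim: k => [|k IHk]; rewrite ?exprS //; apply: OM. Qed.
Lemma Onat k : O k%:R.
Proof. by elim: k => [|k IHk]; [apply: O0 | rewrite -addn1 natrD; apply: OD]. Qed.
Lemma Oint (z : int) : O z%:~R.
Proof.
by case: z => k; rewrite ?NegzE ?rmorphN /=; [|apply: ON]; apply: Onat.
Qed.
Lemma Osum (F : nat -> K) m n : (forall i, (m <= i < n)%N -> O (F i)) ->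
  O (\sum_(m <= i < n) F i).
Proof. by move=> OF; rewrite big_nat; apply: big_ind; [apply: O0|apply: OD|]. Qed.

#[local] Hint Resolve O0 O1 ON OD OB OM OX Onat Oint : oring.

Lemma O_qpoch c x k : O c -> O x -> O (qpoch c x k).
Proof.
move=> Oc Ox; elim: k => [|k IHk]; rewrite ?qpoch0 ?qpochS //.
by auto with oring.
Qed.

Definition dvdO (e x : K) := exists2 o, O o & x = e * o.

Lemma dvdO0 e : dvdO e 0.
Proof. by exists 0; [apply: O0 | rewrite mulr0]. Qed.
Lemma dvdOD e x y : dvdO e x -> dvdO e y -> dvdO e (x + y).
Proof.
by move=> [o Oo ->] [p Op ->]; exists (o + p); [apply: OD|rewrite mulrDr].
Qed.
Lemma dvdOMl e x y : O x -> dvdO e y -> dvdO e (x * y).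
Proof. by move=> Ox [o Oo ->]; exists (x * o); [apply: OM|rewrite mulrCA]. Qed.
Lemma dvdOMr e x y : dvdO e x -> O y -> dvdO e (x * y).
Proof. by move=> ? ?; rewrite mulrC; apply: dvdOMl. Qed.
Lemma dvdO_sum e (F : nat -> K) m n : (forall i, (m <= i < n)%N -> dvdO e (F i)) ->
  dvdO e (\sum_(m <= i < n) F i).
Proof.
by move=> OF; rewrite big_nat; apply: big_ind; [apply: dvdO0|apply: dvdOD|].
Qed.

Variable w : K.
Hypotheses (w_neq0 : w != 0) (Ow : O w) (OwV : O w^-1).
Let e := w - 1.
Let Oe : O e. Proof. exact: OB. Qed.
#[local] Hint Resolve Ow OwV Oe : oring.

Lemma Oexpz (z : int) : O (w ^ z).
Proof. by case: z => k; rewrite ?NegzE -?exprz_inv; apply: OX. Qed.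

(** 1 + z e are the first two terms of the binomial series of (1 + e)^z; the
    induction is on z in both directions, hence the need for w^-1 in O. *)
Lemma expz_first_order (z : int) : dvdO (e ^+ 2) (w ^ z - (1 + e * z%:~R)).
Proof.
elim: z => [|k [o Oo ko]|k [o Oo ko]].
- by rewrite expr0z mulr0 addr0 subrr; apply: dvdO0.
- exists (w * o + k%:R); first by auto with oring.
  move/eqP: ko; rewrite subr_eq intS exprzDr ?unitfE // expr1z => /eqP->.
  by rewrite rmorphD /= /e; ring.
- exists (w^-1 * o + (1 + k%:R) * w^-1); first by auto with oring.
  move/eqP: ko; rewrite subr_eq intS opprD exprzDr ?unitfE // => /eqP->.
  by rewrite rmorphD rmorphN /= exprN1 /e; field.
Qed.

(** A point v lists the exponents of w, three in the numerators and then three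
    in the denominators. Missing entries are 0, so [::] is the origin. *)
Definition lin (v : seq int) (a : nat -> K) : K :=
  \sum_(i < 6) (v`_i)%:~R * a i.

Lemma O_lin v a : (forall i, O (a i)) -> O (lin v a).
Proof.
move=> Oa; apply: big_ind; first exact: O0.
  exact: OD.
by move=> i _; auto with oring.
Qed.

Lemma linD v a b : lin v (fun i => a i + b i) = lin v a + lin v b.
Proof. by rewrite /lin -big_split /=; apply: eq_bigr => i _; rewrite mulrDr. Qed.
Lemma linZ v c a : lin v (fun i => c * a i) = c * lin v a.
Proof. by rewrite /lin mulr_sumr; apply: eq_bigr => i _; rewrite mulrCA. Qed.

(** Affine dependence on the exponents modulo e^2, with all slopes in e O. *)
Definition affine (f : seq int -> K) := exists c a,
  [/\ O c, forall i, O (a i) &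
      forall v, dvdO (e ^+ 2) (f v - (c + e * lin v a))].

Lemma affine_ext f g : f =1 g -> affine f -> affine g.
Proof.
by move=> fg [c [a [Oc Oa fE]]]; exists c, a; split=> // v; rewrite -fg.
Qed.

Lemma affine_cst c : O c -> affine (fun _ => c).
Proof.
move=> Oc; exists c, (fun _ => 0); split=> // [i|v]; first exact: O0.
rewrite /lin big1 => [|i _]; last by rewrite mulr0.
by rewrite mulr0 addr0 subrr; apply: dvdO0.
Qed.

Lemma affine_expz k : (k < 6)%N -> affine (fun v => w ^ v`_k).
Proof.
move=> k6; exists 1, (fun i => (i == k)%:R); split=> // [i|v]; first exact: Onat.
rewrite /lin (bigD1 (Ordinal k6)) //= eqxx big1 => [|i].
  by rewrite mulr1 addr0; apply: expz_first_order.
by rewrite -val_eqE /= => /negPf->; rewrite mulr0.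
Qed.

Lemma affineD f g : affine f -> affine g -> affine (fun v => f v + g v).
Proof.
move=> [c [a [Oc Oa fE]]] [c' [a' [Oc' Oa' gE]]].
exists (c + c'), (fun i => a i + a' i); split=> [|i|v]; do ?exact: OD.
by have := dvdOD (fE v) (gE v); congr dvdO; rewrite linD; ring.
Qed.

Lemma affineM f g : affine f -> affine g -> affine (fun v => f v * g v).
Proof.
move=> [c [a [Oc Oa fE]]] [c' [a' [Oc' Oa' gE]]].
exists (c * c'), (fun i => c * a' i + c' * a i).
split=> [|i|v]; do ?by auto with oring.
have [o Oo /eqP] := fE v; rewrite subr_eq => /eqP->.
have [p Op /eqP] := gE v; rewrite subr_eq => /eqP->.
have := O_lin v Oa; have := O_lin v Oa'; rewrite linD !linZ.
move: (lin v a) (lin v a') => l l' Ol' Ol.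
exists (l * l' + o * (c' + e * l') + p * (c + e * l) + e * (e * (o * p))).
  by auto 10 with oring.
by ring.
Qed.

(** The expansion of the inverse is based at f [::], whose inverse is known to
    lie in O: the constant term c is only congruent to f [::] modulo e^2, and in
    a ring that is not local this does not make it a unit. *)
Lemma affineV f : (forall v, f v != 0) -> (forall v, O (f v)^-1) ->
  affine f -> affine (fun v => (f v)^-1).
Proof.
move=> f0 OfV [c [a [Oc Oa fE]]].
pose h := (f [::])^-1; exists h, (fun i => - h ^+ 2 * a i).
have Oh : O h by exact: OfV.
split=> // [i|v]; first by auto with oring.
have [p Op /eqP] := fE [::]; have [o Oo /eqP] := fE v.
rewrite !subr_eq linZ => /eqP fv /eqP f1.
have lin0 : lin [::] a = 0.
  by rewrite /lin big1 // => i _; rewrite nth_nil mul0r.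
have Ol := O_lin v Oa; have := OfV v; have := f0 v; have := f0 [::].
have fh : f [::] = h^-1 by rewrite /h invrK.
rewrite lin0 in f1; move: fv f1; rewrite fh; set l := lin v a; set k := f v.
move=> kE hE; rewrite invr_eq0 => h0 k0 Ok.
have cE : c = h^-1 - e ^+ 2 * p by rewrite hE; ring.
exists (h * k^-1 * (p - o) + h * h * k^-1 * l * (l + e * (o - p))).
  by auto 10 with oring.
have kl : k = h^-1 + e * l + e ^+ 2 * (o - p) by rewrite kE cE; ring.
rewrite kl in k0 *; field; rewrite h0 /=; apply: contraNneq k0 => k0.
by rewrite -[X in X == _](mulfK h0) -(mul0r h^-1) -k0; apply/eqP; field.
Qed.

Lemma affine_sum (F : nat -> seq int -> K) m n :
    (forall i, (m <= i < n)%N -> affine (F i)) ->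
  affine (fun v => \sum_(m <= i < n) F i v).
Proof.
have aff0 : affine (fun=> 0) by apply/affine_cst/O0.
elim: n => [|n IHn] aF.
  by apply: affine_ext aff0 => v; rewrite big_geq.
have [mn|nm] := leqP m n; last by apply: affine_ext aff0 => v; rewrite big_geq.
have aS : affine (fun v => \sum_(m <= i < n) F i v).
  by apply: IHn => i /andP[mi in_]; apply: aF; rewrite mi ltnW.
have aFn : affine (F n) by apply: aF; rewrite mn ltnSn.
by apply: affine_ext (affineD aS aFn) => v; rewrite big_nat_recr //=.
Qed.

Lemma affine_qpoch c x j k : O c -> O x -> (j < 6)%N ->
  affine (fun v => qpoch (c * w ^ v`_j) x k).
Proof.
move=> Oc Ox j6; elim: k => [|k IHk].
  by apply: affine_ext (affine_cst O1) => v; rewrite qpoch0.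
have aff1 : affine (fun v => 1 + - (c * x ^+ k) * w ^ v`_j).
  apply: affineD; first exact: affine_cst.
  apply: affineM; last exact: affine_expz.
  by apply: affine_cst; auto with oring.
by apply: affine_ext (affineM IHk aff1) => v /=; rewrite qpochS; ring.
Qed.

(** * Blocks of length N *)

(** Here x stands for Q = q^d. By [xN] and [Ounit], N is the order of x modulo
    e; by [Ogeom], 1 - w^m generates the same ideal of O as e. *)
Variables (x : K) (N D t : nat).
Hypotheses (x0 : x != 0) (Ox : O x) (OxV : O x^-1)
  (x_neq1 : forall k, (0 < k)%N -> x ^+ k != 1)
  (xN : x ^+ N = w ^+ D) (D0 : D%:R != 0 :> K) (ODV : O D%:R^-1)
  (t_gt0 : (0 < t)%N) (tN : (2 * t + 1 < N)%N)
  (nz : forall i (j : int), (0 < i < N)%N -> 1 - x ^+ i * w ^ j != 0)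
  (Ounit : forall i (j : int), (0 < i < N)%N -> O (1 - x ^+ i * w ^ j)^-1)
  (Ogeom : forall m, (0 < m)%N -> O (e / (1 - w ^+ m))).

Definition ratio c d k := qpoch c x k / qpoch d x k.

Definition block_term (v : seq int) k :=
  x ^+ k * ratio (x ^+ t * w ^ v`_0) (x * w ^ v`_3) k
    * ratio (x ^+ t * w ^ v`_1) (x * w ^ v`_4) k
    * ratio (x ^- (2 * t + 1) * w ^ v`_2) (x * w ^ v`_5) k.

Definition block_sum v := \sum_(0 <= k < N) block_term v k.

Lemma den_factor (j : int) i : x * w ^ j * x ^+ i = x ^+ i.+1 * w ^ j.
Proof. by rewrite exprS mulrAC. Qed.

Lemma den_neq0 (j : int) k : (k < N)%N -> qpoch (x * w ^ j) x k != 0.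
Proof.
move=> kN; apply: qpoch_neq0 => i ik; rewrite den_factor nz //.
exact: leq_ltn_trans kN.
Qed.

Lemma O_denV (j : int) k : (k < N)%N -> O (qpoch (x * w ^ j) x k)^-1.
Proof.
elim: k => [|k IHk] kN; first by rewrite qpoch0 invr1.
rewrite qpochS invfM den_factor; apply: OM; first by apply: IHk; apply: ltnW.
exact: Ounit.
Qed.

Lemma affine_ratio c i j k : O c -> (i < 6)%N -> (j < 6)%N -> (k < N)%N ->
  affine (fun v => ratio (c * w ^ v`_i) (x * w ^ v`_j) k).
Proof.
move=> Oc i6 j6 kN; apply: affineM; first exact: affine_qpoch.
apply: affineV => [v|v|]; [exact: den_neq0 | exact: O_denV |].
exact: affine_qpoch.
Qed.

Lemma affine_block_sum : affine block_sum.
Proof.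
apply: affine_sum => k /andP[_ kN].
have Oc1 : O (x ^+ t) by exact: OX.
have Oc2 : O (x ^- (2 * t + 1)) by rewrite -exprVn; apply: OX.
do 2?[apply: affineM; last exact: affine_ratio].
apply: affineM; last exact: affine_ratio.
by apply: affine_cst; apply: OX.
Qed.

Lemma block_sum_swap i j k i' j' k' :
  block_sum [:: i; j; k; i'; j'; k'] = block_sum [:: j; i; k; j'; i'; k'].
Proof. by apply: eq_bigr => b _; rewrite /block_term /=; ring. Qed.

(** The third numerator terminates the sum; the two others are polynomials in
    x^k of degree t - 1. *)
Lemma block_sum_at0 : block_sum [::] = 0.
Proof.
have nz1 k : (k < N)%N -> qpoch (x * 1) x k != 0.
  by move=> kN; have := den_neq0 0 kN; rewrite expr0z.
rewrite -(@qsum_vanish _ x (2 * t + 1) t.-1 t.-1 1 1 N) //; last by lia.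
apply: eq_bigr => b _.
by rewrite /block_term /ratio !nth_nil !expr0z !mulr1 prednK //; ring.
Qed.

(** Since x^N = w^D, the first numerator is x^-(N-t) and terminates the sum,
    while the third becomes x^(N-2t-1) w^k, so that its ratio to the third
    denominator, like that of the second pair, is a polynomial in x^b, where b
    is the summation index. *)
Lemma block_sum_terminating (j k : int) :
  block_sum [:: - D%:Z; j; D%:Z + k; 0; j; k] = 0.
Proof.
have wD : w ^+ D != 0 by rewrite expf_neq0.
rewrite -(@qsum_vanish _ x (N - t) t.-1 (N - 2 * t - 2) (w ^ j) (w ^ k) N) //;
  try (by [lia | move=> ? ?; apply: den_neq0]).
apply: eq_bigr => b _; rewrite /block_term /ratio /= expr0z mulr1 prednK //.
have -> : x ^+ t * w ^ (- D%:Z) = x ^- (N - t).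
  apply: (mulIf wD); rewrite -mulrA -exprnN mulVf // mulr1 -xN.
  by apply: (mulfI (expf_neq0 (N - t) x0)); rewrite mulVKf ?expf_neq0 // -exprD subnK //; lia.
have -> : x ^- (2 * t + 1) * w ^ (D%:Z + k) = x ^+ (N - 2 * t - 2).+1 * w ^ k.
  rewrite exprzDr ?unitfE // -exprnP -xN mulrA; congr (_ * _).
  apply: (mulfI (expf_neq0 (2 * t + 1) x0)); rewrite mulVKf ?expf_neq0 //.
  by rewrite -exprD; congr (_ ^+ _); lia.
by ring.
Qed.

Lemma lin_seq6 i j k i' j' k' a : lin [:: i; j; k; i'; j'; k'] a =
  i%:~R * a 0%N + j%:~R * a 1%N + k%:~R * a 2%N
  + i'%:~R * a 3%N + j'%:~R * a 4%N + k'%:~R * a 5%N.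
Proof. by rewrite /lin !big_ord_recr big_ord0 /= add0r. Qed.

(** D (l-1, l-1, l+2; l, l, l) is a combination of the known zeros of the affine
    part L of the block sum; the multiple of L [::] makes the coefficients on
    both sides have the same sum D. *)
Lemma dvdO_block_sum (l : int) :
  dvdO (e ^+ 2) (block_sum [:: l - 1; l - 1; l + 2; l; l; l]).
Proof.
have [c [a [Oc Oa FE]]] := affine_block_sum.
pose L v := c + e * lin v a.
have L0 v : block_sum v = 0 -> dvdO (e ^+ 2) (L v).
  move=> v0; have := dvdOMl (ON O1) (FE v); rewrite v0.
  by congr dvdO; rewrite /L; ring.
have z1 j k := L0 _ (block_sum_terminating j k).
have z2 j k : dvdO (e ^+ 2) (L [:: j; - D%:Z; D%:Z + k; j; 0; k]).
  by apply: L0; rewrite block_sum_swap block_sum_terminating.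
have z0 := L0 _ block_sum_at0.
rewrite -[block_sum _](subrK (L [:: l - 1; l - 1; l + 2; l; l; l])).
apply: dvdOD; first exact: FE.
rewrite -[L _](mulKf D0); apply: dvdOMl => //.
have -> : D%:R * L [:: l - 1; l - 1; l + 2; l; l; l]
  = D%:R * L [:: - D%:Z; l; D%:Z + l; 0; l; l]
    + D%:R * L [:: l; - D%:Z; D%:Z + 0; l; 0; 0]
    + (1 - D%:R) * L [:: - D%:Z; 0; D%:Z + 0; 0; 0; 0]
    + (1 - D%:R) * L [:: 0; - D%:Z; D%:Z + 0; 0; 0; 0]
    + (D%:R - 2%:R) * L [::].
  have -> : L [::] = c.
    by rewrite /L /lin big1 ?mulr0 ?addr0 // => i _; rewrite nth_nil mul0r.
  rewrite /L !lin_seq6 !(rmorphD, rmorphN, rmorphB) /=.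
  by ring.
by do ?apply: dvdOD; apply: dvdOMl => //; auto with oring.
Qed.

(** The summand of the theorem, with q^(-r) = x^t w^-1 and
    q^(2r-d) = x^-(2t+1) w^2. *)
Definition summand k :=
  x ^+ k * ratio (x ^+ t * w^-1) x k * ratio (x ^+ t * w^-1) x k
    * ratio (x ^- (2 * t + 1) * w ^+ 2) x k.

Lemma ratioD c d k m :
  ratio c d (k + m) = ratio c d k * ratio (c * x ^+ k) (d * x ^+ k) m.
Proof. by rewrite /ratio !qpochD invfM; ring. Qed.

Lemma summand_shift m b : let l := (m * D)%:Z in
  summand (m * N + b)
    = summand (m * N) * block_term [:: l - 1; l - 1; l + 2; l; l; l] b.
Proof.
move=> l; rewrite /summand /block_term /= !ratioD exprD.
have -> : x ^+ (m * N) = w ^ l by rewrite mulnC exprM xN -exprM mulnC.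
have -> (c : K) : c * w^-1 * w ^ l = c * w ^ (l - 1).
  by rewrite exprzDr ?unitfE // exprN1; ring.
have -> (c : K) : c * w ^+ 2 * w ^ l = c * w ^ (l + 2).
  by rewrite exprzDr ?unitfE //; ring.
by ring.
Qed.

Lemma dvdO_subX (z : int) : dvdO e (1 - w ^ z).
Proof.
have [o Oo /eqP] := expz_first_order z; rewrite subr_eq => /eqP->.
by exists (- z%:~R - e * o); [auto with oring | ring].
Qed.

(** Among N consecutive denominator factors only the last, 1 - w^((m+1) D), is
    not a unit; it has e as a factor once, and so has the numerator factor at
    position b. *)
Lemma O_ratio c b m (z : int) : O c -> (b < N)%N -> c * x ^+ b = w ^ z ->
  O (ratio c (x * w ^ (m * D)%:Z) N).
Proof.
move=> Oc bN cb.
rewrite /ratio; have [o Oo ->] : dvdO e (qpoch c x N).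
  rewrite -(subnKC bN) qpochD qpochS cb; apply: dvdOMr; last first.
    by apply: O_qpoch => //; apply: OM => //; apply: OX.
  by apply: dvdOMl; [apply: O_qpoch | apply: dvdO_subX].
have N0 : (0 < N)%N by exact: leq_ltn_trans bN.
have := @Ogeom (m.+1 * D).
rewrite -(prednK N0) qpochS den_factor prednK // xN invfM.
have <- : w ^+ (m.+1 * D) = w ^+ D * w ^ (m * D)%:Z by rewrite -exprD mulSn.
move=> Og; have -> (u v : K) : e * o * (u * v) = (e * v) * (o * u) by ring.
apply: OM; last by apply: OM => //; apply: O_denV; rewrite prednK.
by apply: Og; rewrite muln_gt0 /=; case: (D) D0 => //; rewrite eqxx.
Qed.

(** Each numerator of the summand has a factor 1 - w^z in every block: at
    position N - t for x^t, at position 2t + 1 for x^-(2t+1). *)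
Lemma O_summand m : O (summand (m * N)).
Proof.
elim: m => [|m IHm].
  by rewrite /summand /ratio mul0n !qpoch0 divr1 !mulr1.
rewrite mulSnr summand_shift; apply: OM => //; rewrite /block_term /=.
have Oc z : O (x ^+ t * w ^ z) by apply: OM; [apply: OX | apply: Oexpz].
have tb z : x ^+ t * w ^ z * x ^+ (N - t) = w ^ (D%:Z + z).
  rewrite exprzDr ?unitfE // -exprnP -xN mulrAC -exprD; congr (_ ^+ _ * _); lia.
have Od z : O (x ^- (2 * t + 1) * w ^ z).
  by apply: OM; [rewrite -exprVn; apply: OX | apply: Oexpz].
apply: OM; [apply: OM; [apply: OM; first exact: OX|]|].
- by apply: (O_ratio _ _ _ (tb _)) => //; lia.
- by apply: (O_ratio _ _ _ (tb _)) => //; lia.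
- apply: (@O_ratio _ (2 * t + 1) _ ((m * D)%:Z + 2)) => //.
  by rewrite mulrAC mulVf ?expf_neq0 // mul1r.
Qed.

Lemma dvdO_sum_summand g : dvdO (e ^+ 2) (\sum_(0 <= k < g * N) summand k).
Proof.
elim: g => [|g IHg]; first by rewrite big_geq //; apply: dvdO0.
rewrite mulSnr (big_cat_nat (n := (g * N)%N)) ?leq_addr //=.
apply: dvdOD => //; rewrite -{1}[(g * N)%N]add0n big_addn addKn.
under eq_bigr => k _ do rewrite addnC summand_shift.
rewrite -mulr_sumr; apply: dvdOMl; first exact: O_summand.
exact: dvdO_block_sum.
Qed.

End FirstOrder.

(** * Rational functions regular at a cyclotomic polynomial *)

Lemma prod_PhiQ m : (0 < m)%N -> \prod_(k <- divisors m) PhiQ k = 'X^m - 1.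
Proof.
move=> m0; rewrite -rmorph_prod /= prod_Cyclotomic //.
by rewrite rmorphB /= map_polyXn rmorph1.
Qed.

(** X^m - 1 is separable in characteristic 0, so Phi_n divides it only once. *)
Lemma coprime_PhiQ_cofactor n m : (0 < m)%N -> (n %| m)%N ->
  exists2 R : {poly rat}, coprimep R (PhiQ n) & 'X^m - 1 = PhiQ n * R.
Proof.
move=> m0 nm.
have := prod_PhiQ m0; rewrite (big_rem n) -?dvdn_divisors //=.
set R := \prod_(_ <- _) _ => RE; exists R => //.
have : separable_poly ('X^m - 1 : {poly rat}).
  by apply: separable_Xn_sub_1; rewrite Num.Theory.pnatr_eq0 -lt0n.
by rewrite -RE separable_mul coprimep_sym => /and3P[].
Qed.

(** Both polynomials are distinct factors of the separable X^(k n) - 1. *)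
Lemma coprimep_PhiQ n k : (0 < n)%N -> (0 < k)%N -> k != n ->
  coprimep (PhiQ k) (PhiQ n).
Proof.
move=> n0 k0 kn; pose m := (k * n)%N.
have m0 : (0 < m)%N by rewrite muln_gt0 k0.
have := prod_PhiQ m0; rewrite (big_rem n) -?dvdn_divisors ?dvdn_mull //=.
rewrite (big_rem k) /= => [RE|]; last first.
  by rewrite mem_rem_uniq ?divisors_uniq // inE kn -dvdn_divisors ?dvdn_mulr.
have : separable_poly ('X^m - 1 : {poly rat}).
  by apply: separable_Xn_sub_1; rewrite Num.Theory.pnatr_eq0 -lt0n.
rewrite -RE separable_mul => /and3P[_ _].
by rewrite coprimepMr coprimep_sym => /andP[].
Qed.

Lemma coprimep_Xn_sub1_PhiQ n m : (0 < n)%N -> (0 < m)%N -> ~~ (n %| m)%N ->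
  coprimep ('X^m - 1) (PhiQ n).
Proof.
move=> n0 m0 nm; rewrite -prod_PhiQ //.
rewrite big_seq; apply: (big_ind (fun p => coprimep p (PhiQ n))).
- exact: coprime1p.
- by move=> p1 p2 c1 c2; rewrite coprimepMl c1.
move=> k; rewrite -dvdn_divisors // => km.
apply: coprimep_PhiQ => //; first exact: dvdn_gt0 km.
by apply: contraNneq nm => <-.
Qed.

Lemma inv_1subV (K : fieldType) (x : K) : x != 0 -> 1 != x ->
  (1 - x^-1)^-1 = 1 - (1 - x)^-1.
Proof.
move=> x0 x1; have x1' : 1 - x != 0 by rewrite subr_eq0.
have x1'' : x - 1 != 0 by rewrite subr_eq0 eq_sym.
by field; rewrite x0 x1' x1''.
Qed.

Section Regular.
Variable P : {poly rat}.

(** For P = Phi_n this is the local ring O of the introduction. *)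
Definition regular (x : Qq) := exists U V : {poly rat},
  [/\ V != 0, coprimep V P & x = tofrac U / tofrac V].

Lemma regular_tofrac U : regular (tofrac U).
Proof.
by exists U, 1; rewrite oner_neq0 coprime1p rmorph1 divr1.
Qed.

Lemma regular1 : regular 1.
Proof. by rewrite -tofrac1; apply: regular_tofrac. Qed.

Lemma regularB x y : regular x -> regular y -> regular (x - y).
Proof.
move=> [U [V [V0 cV ->]]] [U' [V' [V'0 cV' ->]]].
exists (U * V' - U' * V), (V * V'); rewrite mulf_neq0 // coprimepMl cV cV'.
split=> //; rewrite tofracB !tofracM -mulNr addf_div ?tofrac_eq0 //.
by rewrite mulNr.
Qed.

Lemma regularM x y : regular x -> regular y -> regular (x * y).
Proof.
move=> [U [V [V0 cV ->]]] [U' [V' [V'0 cV' ->]]].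
exists (U * U'), (V * V'); rewrite mulf_neq0 // coprimepMl cV cV'.
by split=> //; rewrite !tofracM mulf_div.
Qed.

Lemma regularV V : V != 0 -> coprimep V P -> regular (tofrac V)^-1.
Proof. by move=> V0 cV; exists 1, V; rewrite tofrac1 mul1r. Qed.

Lemma regular_sqr x : regular x -> rat_congr0 (tofrac P ^+ 2 * x) (P ^+ 2).
Proof.
move=> [U [V [V0 cV ->]]]; exists U, V; split=> //; first exact: coprimep_expr.
by rewrite tofracXn.
Qed.

End Regular.

Lemma q_neq0 : q != 0. Proof. by rewrite tofrac_eq0 polyX_eq0. Qed.

Lemma Xn_sub1_neq0 m : (0 < m)%N -> 'X^m - 1 != 0 :> {poly rat}.
Proof. by move=> m0; rewrite -size_poly_gt0 size_XnsubC. Qed.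

Lemma q_expn m : 1 - q ^+ m = - tofrac ('X^m - 1).
Proof. by rewrite tofracB tofracXn tofrac1 opprB. Qed.

Lemma q_expn_neq1 m : (0 < m)%N -> q ^+ m != 1.
Proof.
by move=> m0; rewrite eq_sym -subr_eq0 q_expn oppr_eq0 tofrac_eq0 Xn_sub1_neq0.
Qed.

Section AtPhi.
Variable n : nat.
Hypothesis n_gt1 : (1 < n)%N.
Let O := regular (PhiQ n).

Lemma regular_qV : O q^-1.
Proof.
apply: regularV; first by rewrite polyX_eq0.
have [R _ RE] := coprime_PhiQ_cofactor (ltnW n_gt1) (dvdnn n).
rewrite coprimep_sym coprimepX; apply/negP => /eqP P0.
have := congr1 (horner^~ 0) RE; rewrite hornerM P0 mul0r !hornerE.
by rewrite expr0n gtn_eqF // ltnW.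
Qed.

Lemma regular_1sub_qXV m : ~~ (n %| m)%N -> O (1 - q ^+ m)^-1.
Proof.
move=> nm; have m0 : (0 < m)%N by case: m nm => //; rewrite dvdn0.
rewrite q_expn invrN -sub0r.
apply: regularB; first by rewrite -tofrac0; apply: regular_tofrac.
apply: regularV; first exact: Xn_sub1_neq0.
by apply: coprimep_Xn_sub1_PhiQ => //; apply: ltnW.
Qed.

Lemma regular_qX m : O (q ^+ m).
Proof. by rewrite -tofracXn; apply: regular_tofrac. Qed.

Lemma regular_1sub_qzV (z : int) : ~~ (n %| `|z|)%N -> O (1 - q ^ z)^-1.
Proof.
case: z => m; first exact: regular_1sub_qXV.
rewrite NegzE abszN absz_nat -exprnN => nm.
rewrite inv_1subV ?expf_neq0 ?q_neq0 1?eq_sym ?q_expn_neq1 //.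
by apply: regularB; [apply: regular1 | apply: regular_1sub_qXV].
Qed.

Lemma q_expz_neq1 (z : int) : z != 0 -> 1 - q ^ z != 0.
Proof.
case: z => m z0; rewrite subr_eq0 eq_sym.
  by apply: q_expn_neq1; rewrite lt0n.
by rewrite NegzE -exprnN invr_eq1 q_expn_neq1.
Qed.

(** Both q^n - 1 and q^(n m) - 1 are Phi_n times a unit. *)
Lemma regular_geom m : (0 < m)%N -> O ((q ^+ n - 1) / (1 - (q ^+ n) ^+ m)).
Proof.
move=> m0; have n0 := ltnW n_gt1.
have [R cR RE] := coprime_PhiQ_cofactor n0 (dvdnn n).
have mn0 : (0 < n * m)%N by rewrite muln_gt0 n0.
have [S cS SE] := coprime_PhiQ_cofactor mn0 (dvdn_mulr m (dvdnn n)).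
have := Xn_sub1_neq0 mn0; rewrite SE mulf_eq0 negb_or => /andP[P0 S0].
rewrite -exprM -[_ - 1]opprB !q_expn RE SE opprK !tofracM invrN mulrN.
rewrite invfM mulrACA mulfV ?tofrac_eq0 // mul1r -sub0r.
apply: regularB; first by rewrite -tofrac0; apply: regular_tofrac.
by apply: regularM; [apply: regular_tofrac | apply: regularV].
Qed.

Lemma rat_congr0_dvdO x :
  dvdO O ((q ^+ n - 1) ^+ 2) x -> rat_congr0 x (PhiQ n ^+ 2).
Proof.
move=> [o Oo ->]; have n0 := ltnW n_gt1.
have [R cR RE] := coprime_PhiQ_cofactor n0 (dvdnn n).
rewrite -opprB q_expn opprK RE tofracM exprMn -mulrA.
apply: regular_sqr; apply: regularM => //.
by rewrite -tofracXn; apply: regular_tofrac.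
Qed.

End AtPhi.

Lemma regular_natV P m : (0 < m)%N -> regular P m%:R^-1.
Proof.
move=> m0; have -> : m%:R = tofrac m%:R%:P :> Qq by rewrite polyC_natr rmorph_nat.
have m1 : m%:R != 0 :> rat by rewrite Num.Theory.pnatr_eq0 -lt0n.
by apply: regularV; [rewrite polyC_eq0 | rewrite -alg_polyC coprimepZl // coprime1p].
Qed.

Lemma natq_neq0 m : (0 < m)%N -> m%:R != 0 :> Qq.
Proof.
move=> m0; have -> : m%:R = tofrac m%:R%:P :> Qq by rewrite polyC_natr rmorph_nat.
by rewrite tofrac_eq0 polyC_eq0 Num.Theory.pnatr_eq0 -lt0n.
Qed.

Lemma regroup_ratios (K : fieldType) (a b c z : K) :
  z * (a / c) * (a / c) * (b / c) = a * (a * (b * 1)) / c ^+ 3 * z.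
Proof. by rewrite !exprS expr0 !invfM invr1; ring. Qed.

(** * The congruence *)

Theorem theorem10 (d r n : nat) (hd : (3 <= d)%N) (hr0 : (0 < r)%N)
    (hrd : (r < d)%N) (h2r : (2 * r)%N <> d) (hn : (d + r <= n)%N)
    (hnr : n = r %[mod d]) :
  rat_congr0
    (\sum_(0 <= k < n)
       qpochs [:: q ^ (- r%:Z); q ^ (- r%:Z); q ^ (2 * r%:Z - d%:Z)] (q ^+ d) k
         / qpoch (q ^+ d) (q ^+ d) k ^+ 3 * q ^+ (d * k))
    (PhiQ n ^+ 2).
Proof.
have n1 : (1 < n)%N by lia.
have [t nE t0] : exists2 t, (n = d * t + r)%N & (0 < t)%N.
  exists (n %/ d)%N; last by rewrite divn_gt0; lia.
  by rewrite {1}(divn_eq n d) hnr (modn_small hrd) mulnC.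
pose g := gcdn n d; pose N := (n %/ g)%N; pose D := (d %/ g)%N.
have g0 : (0 < g)%N by rewrite gcdn_gt0; lia.
have gN : (n = g * N)%N by rewrite mulnC divnK ?dvdn_gcdl.
have gD : (d = g * D)%N by rewrite mulnC divnK ?dvdn_gcdr.
have [r' rE] : exists r', (r = g * r')%N.
  have /dvdnP[r' ->] : (g %| r)%N; last by exists r'; rewrite mulnC.
  by rewrite -(dvdn_addr _ (dvdn_mulr t (dvdn_gcdr n d))) -nE dvdn_gcdl.
have NE : (N = D * t + r')%N.
  by apply/eqP; rewrite -(eqn_pmul2l g0) -gN nE mulnDr mulnA -gD -rE.
have r'0 : (0 < r')%N by move: hr0; rewrite rE muln_gt0 => /andP[].
have r'D : (r' < D)%N by move: hrd; rewrite rE gD ltn_pmul2l.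
(* D = 1 is excluded by 0 < r' < D, and D = 2 would force 2 r = d. *)
have D3 : (2 < D)%N.
  have : (2 * r')%N <> D by move=> rD; apply: h2r; rewrite rE gD -rD mulnCA.
  by move: r'0 r'D; clear; lia.
have tN : (2 * t + 1 < N)%N.
  rewrite NE; apply: leq_trans (leq_add (leq_mul D3 (leqnn t)) r'0).
  by move: t0; clear; lia.
have ndiv i : (0 < i < N)%N -> ~~ (n %| d * i)%N.
  move=> /andP[i0 iN]; rewrite gD {1}gN -mulnA dvdn_pmul2l //.
  rewrite Gauss_dvdr; first by rewrite gtnNdvd.
  rewrite /coprime -(eqn_pmul2l g0) muln_gcdr -gN -gD muln1.
  by rewrite -/g eqxx.
have qd i (j : int) : (q ^+ d) ^+ i * (q ^+ n) ^ j = q ^ ((d * i)%:Z + n%:Z * j).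
  by rewrite -exprM exprzDr ?unitfE ?q_neq0 // -exprz_exp -!exprnP.
have ndz i (j : int) : (0 < i < N)%N -> ~~ (n %| absz ((d * i)%:Z + n%:Z * j)%R)%N.
  move=> iN; apply: contra (ndiv i iN) => h.
  have : (n%:Z %| (d * i)%:Z + n%:Z * j)%Z by [].
  by rewrite rpredDr // dvdz_mulr.
have q0 m : q ^+ m != 0 by rewrite expf_neq0 ?q_neq0.
have qX := regular_qX n; have qV m : regular (PhiQ n) (q ^+ m)^-1.
  by rewrite -exprVn; apply: OX; [apply: regular1|apply: regularM|apply: regular_qV].
pose O := regular (PhiQ n).
have main : dvdO O ((q ^+ n - 1) ^+ 2)
    (\sum_(0 <= k < g * N) summand (q ^+ n) (q ^+ d) t k).
  apply: (@dvdO_sum_summand _ O _ _ _ _ _ _ _ _ _ D) => //.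
  - exact: regular1.
  - exact: regularB.
  - exact: regularM.
  - exact: q0.
  - exact: qX.
  - exact: qV.
  - exact: q0.
  - exact: qX.
  - exact: qV.
  - by move=> k k0; rewrite -exprM q_expn_neq1 // muln_gt0 k0; case: (d) hd.
  - by rewrite -!exprM {1}gD {1}gN -!mulnA [(D * N)%N]mulnC.
  - by rewrite natq_neq0 // ltnW // ltnW.
  - by apply: regular_natV; rewrite ltnW // ltnW.
  - move=> i j iN; rewrite qd q_expz_neq1 //.
    by apply: contraNneq (ndz i j iN) => ->; rewrite dvdn0.
  - by move=> i j iN; rewrite qd; apply: regular_1sub_qzV => //; apply: ndz.
  - exact: regular_geom.
apply: rat_congr0_dvdO => //; move: main; rewrite -gN; congr dvdO.
apply: eq_bigr => k _; rewrite /summand /ratio /qpochs !big_cons big_nil.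
have -> : q ^ (- r%:Z) = (q ^+ d) ^+ t * (q ^+ n)^-1.
  apply: (mulIf (q0 n)); rewrite divfK //.
  rewrite -exprnN mulrC nE exprD -mulrA mulfV ?mulr1 //.
  by rewrite exprM.
have -> : q ^ (2 * r%:Z - d%:Z) = (q ^+ d) ^- (2 * t + 1) * (q ^+ n) ^+ 2.
  have -> : 2 * r%:Z - d%:Z = n%:Z * 2 - (d * (2 * t + 1))%:Z.
    by rewrite nE; clear; lia.
  rewrite exprzDr ?unitfE ?q_neq0 // -exprz_exp -exprnN -exprM.
  by rewrite -!exprnP mulrC.
by rewrite exprM; apply: regroup_ratios.
Qed.
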